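(* Let $(\lambda_N)_{N\ge1}$ be a sequence with $0<\lambda_N<1$ and $\lambda_N=o(1/N^H)$, and let $(q_N)_{N\ge1}$ be a sequence of strictly positive numbers such that $$\frac{q_N}{N^H}\xrightarrow[N\to\infty]{}\infty\quad\text{and}\quad \lambda_Nq_N\xrightarrow[N\to\infty]{}0.$$ Then the self-financing strategies $\widehat\phi^N:=q_N\,\phi^N(\lambda_N,n_H)$ (with $\phi^N(\lambda,n_0)$ and $n_H$ as in the context, $N\geq n_H$) provide a $1$-step $\{\lambda_N\}_{N\ge1}$-asymptotic arbitrage of the first kind in the sequence of fractional binary markets.
   Context: Fix $H\in(1/2,1)$, $\sigma>0$, $s_0>0$. Let $(\xi_i)_{i\ge1}$ be i.i.d. with $P(\xi_1=1)=P(\xi_1=-1)=1/2$, $\mathcal F_i=\sigma(\xi_1,\dots,\xi_i)$ ($\mathcal F_0$ and $\mathcal F_{-1}$ trivial). Set $c_H=\sqrt{\frac{2H\,\Gamma(\frac32-H)}{\Gamma(H+\frac12)\,\Gamma(2-2H)}}$ and, for $n\ge1$, $1\le i\le n-1$, $$j_n(i)=\sigma c_H\left(H-\tfrac12\right)\int_{i-1}^{i}x^{\frac12-H}\left(\int_0^1 (v+n-1)^{H-\frac12}(v+n-1-x)^{H-\frac32}\,dv\right)dx,$$ $$g_n=\sigma c_H\left(H-\tfrac12\right)\int_{n-1}^{n}x^{\frac12-H}(n-x)^{H-\frac12}\left(\int_0^1 (y(n-x)+x)^{H-\frac12}y^{H-\frac32}\,dy\right)dx,$$ and $X_n=\sum_{i=1}^{n-1}j_n(i)\xi_i+g_n\xi_n$.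 The $N$-fractional binary market ($N>1$, without drift) has bond identically $1$ and stock $S^{(N)}_0=s_0$, $S_n^{(N)}=\left(1+\frac{X_n}{N^H}\right)S_{n-1}^{(N)}$, $1\le n\le N$, adapted to $(\mathcal F_n)_{n=0}^N$. For $\lambda\in[0,1]$, a $\lambda$-self-financing strategy for $S=(S_n)_{n=0}^N$ is an adapted process $\phi=(\phi^0_n,\phi^1_n)_{n=-1}^N$ with, for all $n\in\{0,\dots,N\}$, $$\phi_n^0-\phi_{n-1}^0\le -(\phi_n^1-\phi_{n-1}^1)^+S_n+(1-\lambda)(\phi_n^1-\phi_{n-1}^1)^-S_n.$$ Its liquidation value is $V_n^\lambda(\phi)=\phi_n^0+(1-\lambda)(\phi_n^1)^+S_n-(\phi_n^1)^-S_n$. It has zero endowment if $(\phi^0_{-1},\phi^1_{-1})=(0,0)$. Let $n_H\ge1$ be a fixed integer such that $-\sum_{i=1}^{n-1}j_n(i)+g_n<0$ for all $n\ge n_H$ (such an integer exists, by a known result of Sottinen). Write $\vec\xi_k=(\xi_1,\dots,\xi_k)$ and $\vec 1_k=(1,\dots,1)\in\mathbb R^k$. For $\lambda\in[0,1]$, $N\ge n_H$ and $n_0\in\{n_H,\dots,N\}$, the strategy $\phi^N(\lambda,n_0)=(\phi^{N,0}(\lambda,n_0),\phi^{N,1}(\lambda,n_0))$ is defined, with $E=\{\vec\xi_{n_0-1}=-\vec1_{n_0-1}\}$, by: - $\phi^{N,0}_i=\phi^{N,1}_i=0$ for $i\le n_0-2$; - $\phi^{N,0}_{n_0-1}=(1-\lambda)S^{(N)}_{n_0-1}\mathbf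 1_{E}$, $\phi^{N,1}_{n_0-1}=-\mathbf 1_E$; - $\phi^{N,0}_{n}=\left((1-\lambda)S^{(N)}_{n_0-1}-S^{(N)}_{n_0}\right)\mathbf 1_{E}$, $\phi^{N,1}_{n}=0$ for $n_0\le n\le N$. A $1$-step strategy is one that does nothing until a fixed time, then, depending on the past, goes long or short in the stock, and liquidates this position at the very next time step, doing nothing afterwards. $\lambda_N$-self-financing strategies $\phi^N$ with zero endowment in the $N$-fractional binary markets provide an asymptotic arbitrage of the first kind with transaction costs $\{\lambda_N\}$ if, along a subsequence of markets (again denoted by $N$), there are sequences of strictly positive reals $c_N\to0$ and $C_N\to\infty$ such that (1) $V_i^{\lambda_N}(\phi^N)\ge -c_N$ for all $i=0,\dots,N$, and (2) $\lim_{N\to\infty}P\left(V_N^{\lambda_N}(\phi^N)\ge C_N\right)>0$. It is called a $1$-step asymptotic arbitrage if all the strategies are $1$-step. *)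

(* Defs.v *)
From HB Require Import structures.
From mathcomp Require Import all_boot all_order all_algebra.
From mathcomp Require Import all_classical all_reals all_analysis.
Set Implicit Arguments.
Unset Strict Implicit.
Unset Printing Implicit Defensive.
Import Order.TTheory GRing.Theory Num.Theory.
Import numFieldNormedType.Exports.
Local Open Scope classical_set_scope.
Local Open Scope ring_scope.

Section Kernels.
Context {R : realType}.
Implicit Types H sigma : R.

Let mu := @lebesgue_measure R.

Definition Gamma (s : R) : R :=
  \int[mu]_(t in `]0, +oo[) (t `^ (s - 1) * expR (- t)).

Definition cH H : R :=
  Num.sqrt (2 * H * Gamma (3 / 2 - H) / (Gamma (H + 1 / 2) * Gamma (2 - 2 * H))).

(* For 1 <= i < n the integrands below are nonnegative and integrable when
   1/2 < H < 1. At a singular endpoint [powR] yields 0 `^ p = 0 for p < 0,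
   which only affects a null set. *)
Definition jker H sigma (n i : nat) : R :=
  sigma * cH H * (H - 1 / 2) *
  \int[mu]_(x in `[i%:R - 1, i%:R])
    (x `^ (1 / 2 - H) *
     \int[mu]_(v in `[0, 1])
       ((v + n%:R - 1) `^ (H - 1 / 2) * (v + n%:R - 1 - x) `^ (H - 3 / 2))).

Definition gker H sigma (n : nat) : R :=
  sigma * cH H * (H - 1 / 2) *
  \int[mu]_(x in `[n%:R - 1, n%:R])
    (x `^ (1 / 2 - H) * (n%:R - x) `^ (H - 1 / 2) *
     \int[mu]_(y in `[0, 1])
       ((y * (n%:R - x) + x) `^ (H - 1 / 2) * y `^ (H - 3 / 2))).

End Kernels.

Section Coins.
Context {d : measure_display} {T : measurableType d} {R : realType}.
Variable P : probability T R.

Definition mutually_independent (I : choiceType) (D : set I)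
    (X : I -> {RV P >-> R}) : Prop :=
  forall (s : seq I) (B : I -> set R), uniq s ->
    (forall i, i \in s -> D i /\ measurable (B i)) ->
    P (\bigcap_(i in [set` s]) (X i @^-1` B i)) =
    (\prod_(i <- s) P (X i @^-1` B i))%E.

(* The sequence is indexed from 1; the term of index 0 is never used. *)
Definition iid_fair_signs (xi : nat -> {RV P >-> R}) : Prop :=
  mutually_independent [set i | (1 <= i)%N] xi /\
  forall i, (1 <= i)%N ->
    P [set w | xi i w = 1] = (1 / 2)%:E /\ P [set w | xi i w = -1] = (1 / 2)%:E.

(* Time is an [int] so as to include -1: for n <= 0 no generator is selected
   and the sigma-algebra is trivial. *)
Definition coin_filtration (xi : nat -> T -> R) (n : int) : set (set T) :=
  <<s \bigcup_(i in [set i : nat | (1 <= i)%N /\ i%:Z <= n])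
        preimage_set_system setT (xi i) measurable >>.

Definition Xfbm (H sigma : R) (xi : nat -> T -> R) (n : nat) (w : T) : R :=
  \sum_(1 <= i < n) jker H sigma n i * xi i w + gker H sigma n * xi n w.

Fixpoint fbm_stock (H sigma s0 : R) (xi : nat -> T -> R) (N n : nat) (w : T) : R :=
  if n is n'.+1 then
    (1 + Xfbm H sigma xi n w / N%:R `^ H) * fbm_stock H sigma s0 xi N n' w
  else s0.

End Coins.

Section Trading.
Context {d : measure_display} {T : measurableType d} {R : realType}.
Variable P : probability T R.

(* Only the times -1, ..., N matter in the N-th market. *)
Record strategy := Strategy {
  bond : int -> T -> R;   (* phi^0 *)
  shares : int -> T -> R  (* phi^1 *)
}.

Definition scale_strategy (q : R) (phi : strategy) : strategy :=
  Strategy (fun n w => q * bond phi n w) (fun n w => q * shares phi n w).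

Definition adapted (F : int -> set (set T)) (N : nat) (phi : strategy) : Prop :=
  forall n : int, -1 <= n <= N%:Z -> forall B : set R, measurable B ->
    F n (bond phi n @^-1` B) /\ F n (shares phi n @^-1` B).

Definition pospart (x : R) : R := Num.max x 0.
Definition negpart (x : R) : R := Num.max (- x) 0.

Definition self_financing (F : int -> set (set T)) (S : nat -> T -> R)
    (N : nat) (lam : R) (phi : strategy) : Prop :=
  adapted F N phi /\
  forall (n : nat) (w : T), (n <= N)%N ->
    let trade := shares phi n%:Z w - shares phi (n%:Z - 1) w in
    bond phi n%:Z w - bond phi (n%:Z - 1) w <=
      - pospart trade * S n w + (1 - lam) * negpart trade * S n w.

Definition zero_endowment (phi : strategy) : Prop :=
  forall w, bond phi (-1) w = 0 /\ shares phi (-1) w = 0.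

Definition liquidation_value (S : nat -> T -> R) (lam : R) (phi : strategy)
    (n : nat) (w : T) : R :=
  bond phi n%:Z w + (1 - lam) * pospart (shares phi n%:Z w) * S n w
  - negpart (shares phi n%:Z w) * S n w.

(* No trade before time m, a position in the stock is opened at time m (which
   may be null on some paths, but not almost surely), it is liquidated at time
   m + 1 and there is no trade afterwards. *)
Definition one_step (N : nat) (phi : strategy) : Prop :=
  exists m : nat, [/\ (m < N)%N,
    forall (n : nat) w, (n < m)%N ->
      bond phi n%:Z w = bond phi (n%:Z - 1) w /\
      shares phi n%:Z w = shares phi (n%:Z - 1) w,
    (0 < P [set w | shares phi m%:Z w != 0%R])%E,
    forall w, shares phi (m.+1)%:Z w = 0 &
    forall (n : nat) w, (m.+1 < n <= N)%N ->
      bond phi n%:Z w = bond phi (n%:Z - 1) w /\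
      shares phi n%:Z w = shares phi (n%:Z - 1) w].

(* S N is the stock of the N-th market, N > 1, and phi N is a strategy for it,
   given for N >= N0; [sub] enumerates the subsequence of markets. The
   inequality between random variables in the admissibility condition is
   almost sure: it can fail on the null set where some coin is not 1 or -1. *)
Definition asymptotic_arbitrage1 (F : int -> set (set T))
    (S : nat -> nat -> T -> R) (lambda : nat -> R) (N0 : nat)
    (phi : nat -> strategy) : Prop :=
  (forall N, (1 < N)%N -> (N0 <= N)%N ->
     self_financing F (S N) N (lambda N) (phi N) /\ zero_endowment (phi N)) /\
  exists (sub : nat -> nat) (c C : nat -> R),
    [/\ {homo sub : k l / (k < l)%N},
        forall k, (1 < sub k)%N /\ (N0 <= sub k)%N,
        (forall k, 0 < c k) /\ c @ \oo --> 0,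
        (forall k, 0 < C k) /\ C @ \oo --> +oo &
        (forall k i, (i <= sub k)%N ->
           {ae P, forall w, - c k <=
              liquidation_value (S (sub k)) (lambda (sub k)) (phi (sub k)) i w}) /\
        exists2 p : R, 0 < p &
          P [set w | C k <= liquidation_value (S (sub k)) (lambda (sub k))
                              (phi (sub k)) (sub k) w] @[k --> \oo] --> p%:E].

Definition one_step_asymptotic_arbitrage1 (F : int -> set (set T))
    (S : nat -> nat -> T -> R) (lambda : nat -> R) (N0 : nat)
    (phi : nat -> strategy) : Prop :=
  asymptotic_arbitrage1 F S lambda N0 phi /\
  forall N, (1 < N)%N -> (N0 <= N)%N -> one_step N (phi N).

Definition all_tails (xi : nat -> T -> R) (k : nat) : set T :=
  [set w | forall i, (1 <= i <= k)%N -> xi i w = -1].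

(* phi(lam, n0) for the stock S; intended for 1 <= n0. *)
Definition short_strategy (xi : nat -> T -> R) (S : nat -> T -> R) (lam : R)
    (n0 : nat) : strategy :=
  let E := all_tails xi (n0 - 1) in
  Strategy
    (fun (n : int) w =>
       if n <= n0%:Z - 2 then 0
       else if n == n0%:Z - 1 then (1 - lam) * S (n0 - 1)%N w * \1_E w
       else ((1 - lam) * S (n0 - 1)%N w - S n0 w) * \1_E w)
    (fun (n : int) w => if n == n0%:Z - 1 then - \1_E w else 0).

End Trading.

(* Main.v *)
(** Put m = n_H - 1. On the event E = {xi_1 = ... = xi_m = -1}, of probability
2^-m, the price S_m is deterministic and tends to s_0 as N goes to infinity,
while the next increment X_(m+1) is at most -a < 0 for either value of the next
coin. Selling q_N shares short at time m on E therefore costs at most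
lambda_N q_N S_m <= 2 s_0 lambda_N q_N -> 0 before liquidation, and yields
q_N S_m (- X_(m+1) / N^H - lambda_N) >= (a s_0 / 4) q_N / N^H -> +oo afterwards,
because lambda_N = o(1 / N^H). *)
Require Import Defs.
From HB Require Import structures.
From mathcomp Require Import all_boot all_order all_algebra.
From mathcomp Require Import all_classical all_reals all_analysis.
From mathcomp Require Import measurable_realfun zify ring lra.
Import Order.TTheory GRing.Theory Num.Theory.
Import numFieldNormedType.Exports.
Local Open Scope classical_set_scope.
Local Open Scope ring_scope.

(** * Prices along a fixed path of coins, and their limit in [N] *)

Lemma Xfbm_eq (d d' : measure_display) (T : measurableType d)
  (T' : measurableType d') (R : realType) (H sigma : R) (n : nat)
  (xi : nat -> T -> R) (xi' : nat -> T' -> R) (w : T) (w' : T') :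
  (1 <= n)%N -> (forall i, (1 <= i <= n)%N -> xi i w = xi' i w') ->
  Xfbm H sigma xi n w = Xfbm H sigma xi' n w'.
Proof.
move=> n0 e; rewrite /Xfbm (e n) ?n0 ?leqnn//; congr (_ + _).
apply: eq_big_nat => i /andP[i1 ilt].
by rewrite e// i1 ltnW.
Qed.

(** Allowing two coin families at two sample points makes it possible to replace the random price on
    an all-tails path by that of a constant, deterministic path. *)
Lemma fbm_stock_eq (d d' : measure_display) (T : measurableType d)
  (T' : measurableType d') (R : realType) (H sigma s0 : R) (N n : nat)
  (xi : nat -> T -> R) (xi' : nat -> T' -> R) (w : T) (w' : T') :
  (forall i, (1 <= i <= n)%N -> xi i w = xi' i w') ->
  fbm_stock H sigma s0 xi N n w = fbm_stock H sigma s0 xi' N n w'.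
Proof.
elim: n => [//|n IH] e; cbn [fbm_stock].
rewrite (@Xfbm_eq _ _ _ _ _ H sigma n.+1 xi xi' w w')// IH// => i /andP[i1 ilt].
by rewrite e// i1 ltnW.
Qed.

Lemma natr_powR_cvgy (R : realType) (H : R) : 0 < H ->
  N%:R `^ H @[N --> \oo] --> +oo.
Proof.
move=> H0; apply/cvgryPge => A.
have [A0|A0] := leP A 0; first by apply: nearW => N; rewrite (le_trans A0)// powR_ge0.
apply: filterS (nbhs_infty_ger (A `^ H^-1)) => N leN.
have -> : A = (A `^ H^-1) `^ H by rewrite -powRrM mulVf ?gt_eqF// powRr1// ltW.
by apply: ge0_ler_powR; rewrite ?nnegrE ?powR_ge0// ltW.
Qed.

(** The time [n] stays fixed while the market index [N] grows: the price is [s0] times [n] factors,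
    each tending to 1. *)
Lemma fbm_stock_cvg (d : measure_display) (T : measurableType d)
  (R : realType) (H sigma s0 : R) (xi : nat -> T -> R) (n : nat) (w : T) :
  0 < H -> fbm_stock H sigma s0 xi N n w @[N --> \oo] --> s0.
Proof.
move=> H0; elim: n => [|n IH]; first exact: cvg_cst.
rewrite [X in _ --> X](_ : _ = (1 + Xfbm H sigma xi n.+1 w * 0) * s0); last first.
  by rewrite mulr0 addr0 mul1r.
apply: cvgM => //; apply: cvgD; first exact: cvg_cst.
apply: cvgM; first exact: cvg_cst.
apply/gtr0_cvgV0; last exact: natr_powR_cvgy.
by near=> N; rewrite powR_gt0// ltr0n; near: N; exists 1%N.
Unshelve. all: by end_near. Qed.

(** * Measurability of prices and of the all-tails event *)

Section measurability.
Context {d : measure_display} {T : measurableType d} {R : realType}.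
Variables (H sigma s0 : R) (xi : nat -> T -> R).

Lemma measurable_Xfbm (n : nat) : (1 <= n)%N ->
  (forall i, (1 <= i <= n)%N -> measurable_fun setT (xi i)) ->
  measurable_fun setT (Xfbm H sigma xi n).
Proof.
move=> n1 mxi.
apply: measurable_funD; last first.
  by apply: measurable_funM => //; apply: mxi; rewrite n1 leqnn.
(* [measurable_sum] requires every summand to be measurable, including those with index outside the
   range, where nothing is known of [xi i]; these are replaced by 0. *)
rewrite (_ : (fun w => _) = fun w => \sum_(1 <= i < n)
    jker H sigma n i * (if (1 <= i <= n)%N then xi i else cst 0) w).
  apply: measurable_sum => i; apply: measurable_funM => //.
  by case: ifP => // /mxi.
apply/funext => w; apply: eq_big_nat => i /andP[i1 ilt].
by rewrite i1 ltnW.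
Qed.

Lemma measurable_fbm_stock (N n : nat) :
  (forall i, (1 <= i <= n)%N -> measurable_fun setT (xi i)) ->
  measurable_fun setT (fbm_stock H sigma s0 xi N n).
Proof.
elim: n => [_|n IH mxi]; first exact: measurable_cst.
have IHn : measurable_fun setT (fbm_stock H sigma s0 xi N n).
  by apply: IH => i /andP[i1 ilt]; apply: mxi; rewrite i1 ltnW.
apply: measurable_funM => //; apply: measurable_funD => //.
by apply: measurable_funM => //; exact: measurable_Xfbm.
Qed.

(** A finite intersection over a duplicate-free list is the form that both measurability and
    independence call for. *)
Lemma all_tailsE (n : nat) :
  all_tails xi n = \bigcap_(i in [set` iota 1 n]) xi i @^-1` [set -1].
Proof.
apply/seteqP; split => w /= h i.
  by rewrite /= mem_iota add1n ltnS => ?; exact: h.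
by move=> ?; apply: h; rewrite /= mem_iota add1n ltnS.
Qed.

Lemma measurable_all_tails (n : nat) :
  (forall i, (1 <= i <= n)%N -> measurable_fun setT (xi i)) ->
  measurable (all_tails xi n).
Proof.
move=> mxi; rewrite all_tailsE; apply: fin_bigcap_measurable => //.
move=> i /=; rewrite mem_iota add1n ltnS => ilt.
by rewrite -[X in measurable X]setTI; exact: mxi.
Qed.

End measurability.

(** * Holdings of the short strategy, with [n0] written [m.+1] so that the sale is at time [m] *)

Section short_strategy.
Context {d : measure_display} {T : measurableType d} {R : realType}.
Variables (xi : nat -> T -> R) (S : nat -> T -> R) (lam : R) (m : nat).
Let E := all_tails xi m.
Let phi := short_strategy xi S lam m.+1.

Lemma bond_short_lt (n : int) w : n < m%:Z -> bond phi n w = 0.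
Proof. by move=> nm; rewrite /phi/=; case: ifPn => //; lia. Qed.

Lemma bond_short_eq w : bond phi m%:Z w = (1 - lam) * S m w * \1_E w.
Proof.
rewrite /phi/= ifF; last by lia.
by rewrite ifT ?subn1//; lia.
Qed.

Lemma bond_short_gt (n : int) w : m%:Z < n ->
  bond phi n w = ((1 - lam) * S m w - S m.+1 w) * \1_E w.
Proof.
move=> nm; rewrite /phi/= ifF; last by lia.
by rewrite ifF ?subn1//; lia.
Qed.

Lemma shares_short_eq w : shares phi m%:Z w = - \1_E w.
Proof. by rewrite /phi/= ifT ?subn1//; lia. Qed.

Lemma shares_short_neq (n : int) w : n != m%:Z -> shares phi n w = 0.
Proof. by move=> nm; rewrite /phi/= ifF//; lia. Qed.

End short_strategy.

(** Naming the generators of [coin_filtration] allows [T] to be equipped with that sigma-algebra, so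
    that adaptedness becomes measurability and the lemmas above apply. *)
Definition coin_generators {d : measure_display} {T : measurableType d}
    {R : realType} (xi : nat -> T -> R) (n : int) : set (set T) :=
  \bigcup_(i in [set i : nat | (1 <= i)%N /\ i%:Z <= n])
    preimage_set_system setT (xi i) measurable.

(** * Adaptedness and the self-financing condition *)

Section filtration.
Context {d : measure_display} {T : measurableType d} {R : realType}.
Variables (H sigma s0 : R) (xi : nat -> T -> R).

Lemma measurable_coin (n : int) (i : nat) : (1 <= i)%N -> i%:Z <= n ->
  measurable_fun (T := g_sigma_algebraType (coin_generators xi n)) setT (xi i).
Proof.
move=> i1 ilen _ B mB.
by apply: sub_sigma_algebra; exists i => //; exists B.
Qed.

Lemma coin_filtration_preimage (n : int) (f : T -> R) (B : set R) :
  measurable_fun (T := g_sigma_algebraType (coin_generators xi n)) setT f ->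
  measurable B -> coin_filtration xi n (f @^-1` B).
Proof. by move=> mf mB; rewrite -[f @^-1` B]setTI; exact: mf. Qed.

(** The budget inequality is an equality at every time: the bond receives exactly the proceeds of
    the sale at [m], and pays exactly the repurchase at [m.+1]. *)
Lemma short_strategy_self_financing (N m : nat) (lam q : R) : 0 <= q ->
  self_financing (coin_filtration xi) (fbm_stock H sigma s0 xi N) N lam
    (scale_strategy q
      (short_strategy xi (fbm_stock H sigma s0 xi N) lam m.+1)).
Proof.
move=> q0; split.
  move=> n _ B mB.
  pose U := g_sigma_algebraType (coin_generators xi n).
  have mS k : k%:Z <= n ->
      measurable_fun (T := U) setT (fbm_stock H sigma s0 xi N k).
    move=> kn; apply: (@measurable_fbm_stock _ U) => i /andP[i1 ik].
    by apply: measurable_coin => //; lia.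
  have mE : m%:Z <= n ->
      measurable_fun (T := U) setT (\1_(all_tails xi m) : T -> R).
    move=> mn; apply: measurable_indic.
    apply: (@measurable_all_tails _ U) => i /andP[i1 ik].
    by apply: measurable_coin => //; lia.
  split; apply: coin_filtration_preimage => //; apply: measurable_funM => //.
  - have [nm|mn|nm] := ltgtP n m%:Z.
    + rewrite (_ : bond _ _ = cst 0)//; apply/funext => w.
      exact: bond_short_lt.
    + rewrite (_ : bond _ _ = fun w =>
        ((1 - lam) * fbm_stock H sigma s0 xi N m w -
          fbm_stock H sigma s0 xi N m.+1 w) * \1_(all_tails xi m) w); last first.
        by apply/funext => w; exact: bond_short_gt.
      apply: measurable_funM; last by apply: mE; lia.
      apply: measurable_funB; last by apply: mS; lia.
      by apply: measurable_funM => //; apply: mS; lia.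
    + rewrite (_ : bond _ _ = fun w =>
        (1 - lam) * fbm_stock H sigma s0 xi N m w * \1_(all_tails xi m) w); last first.
        by apply/funext => w; rewrite nm bond_short_eq.
      apply: measurable_funM; last by apply: mE; lia.
      by apply: measurable_funM => //; apply: mS; lia.
  - have [nm|nm] := eqVneq n m%:Z.
      rewrite (_ : shares _ _ = fun w => - \1_(all_tails xi m) w); last first.
        by apply/funext => w; rewrite nm shares_short_eq.
      by apply: measurable_funN; apply: mE; lia.
    rewrite (_ : shares _ _ = cst 0)//; apply/funext => w.
    exact: shares_short_neq.
move=> n w nN; cbn [bond shares scale_strategy]; rewrite /pospart /negpart.
set E := all_tails xi m; set S := fbm_stock H sigma s0 xi N.
have E0 : 0 <= q * \1_E w by rewrite mulr_ge0// indicE; case: (w \in E).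
have maxr0 (x : R) : 0 <= x -> Num.max x 0 = x /\ Num.max (- x) 0 = 0.
  by move=> x0; split; [apply/max_idPl|apply/max_idPr; lra].
have [E1 E2] := maxr0 _ E0.
have [nm|mn|nm] := ltngtP n m.
- rewrite !bond_short_lt ?shares_short_neq; try lia.
  by rewrite mulr0 subrr oppr0 maxxx; lra.
- have [mn1|mn1] := ltnP m.+1 n.
    rewrite !bond_short_gt ?shares_short_neq; try lia.
    by rewrite mulr0 !subrr oppr0 maxxx; lra.
  have -> : n = m.+1 by lia.
  rewrite (_ : m.+1%:Z - 1 = m%:Z); last by lia.
  rewrite bond_short_gt; last by lia.
  rewrite bond_short_eq shares_short_eq shares_short_neq; last by lia.
  rewrite (_ : q * 0 - q * - \1_E w = q * \1_E w); last by ring.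
  by rewrite E1 E2; lra.
rewrite nm bond_short_eq shares_short_eq bond_short_lt ?shares_short_neq; try lia.
rewrite (_ : q * - \1_E w - q * 0 = - (q * \1_E w)); last by ring.
by rewrite opprK E1 E2; lra.
Qed.
End filtration.

(** * Probabilities of coin events *)

Section fair_coins.
Context {d : measure_display} {T : measurableType d} {R : realType}
  {P : probability T R} {xi : nat -> {RV P >-> R}}.
Hypothesis hxi : iid_fair_signs xi.

Lemma probability_all_tails (n : nat) : P (all_tails xi n) = ((1 / 2) ^+ n)%:E.
Proof.
have [indep fair] := hxi.
rewrite all_tailsE (indep (iota 1 n) (fun=> [set -1])) ?iota_uniq//; last first.
  by move=> i; rewrite mem_iota => /andP[].
rewrite big_seq (eq_bigr (fun=> (1 / 2 : R)%:E)) => [|i].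
  rewrite -big_seq prodEFin; congr (_%:E).
  by rewrite big_const_seq count_predT size_iota iter_mulr_1.
by rewrite mem_iota => /andP[/fair[_ <-]].
Qed.

(** The two disjoint events have probability 1/2 each, so nothing is left for the complement. *)
Lemma fair_coin_ae (i : nat) : (1 <= i)%N ->
  {ae P, forall w, xi i w = 1 \/ xi i w = -1}.
Proof.
move=> i1; have [_ /(_ _ i1)[P1 PN1]] := hxi.
have mxi (x : R) : measurable [set w | xi i w = x].
  by exact: (measurable_funPTI (xi i) (measurable_set1 x)).
have mU := measurableU _ _ (mxi 1) (mxi (-1)).
exists (~` ([set w | xi i w = 1] `|` [set w | xi i w = -1])); split.
- exact: measurableC.
- rewrite probability_setC// (_ : P _ = 1%:E) ?subee//.
  rewrite measureU//.
    apply: etrans (f_equal2 adde P1 PN1) _; congr (_%:E) => /=; lra.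
  by rewrite -subset0 => w /= [->]; lra.
- by move=> w /=.
Qed.

End fair_coins.

(** This sign makes heads the worse outcome of the last coin for a short seller. *)
Lemma gker_ge0 (R : realType) (H sigma : R) (n : nat) :
  1 / 2 < H -> 0 < sigma -> 0 <= gker H sigma n.
Proof.
move=> hH hs; rewrite /gker mulr_ge0//.
  by rewrite !mulr_ge0 ?sqrtr_ge0//; lra.
apply: Rintegral_ge0 => x _; rewrite !mulr_ge0 ?powR_ge0//.
by apply: Rintegral_ge0 => y _; rewrite !mulr_ge0 ?powR_ge0.
Qed.

(** * Liquidation values before, at and after the short sale *)

Section liquidation.
Context {d : measure_display} {T : measurableType d} {R : realType}.
Variables (xi : nat -> T -> R) (S : nat -> T -> R) (lam q : R) (m : nat).
Let E := all_tails xi m.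
Let V := liquidation_value S lam (scale_strategy q (short_strategy xi S lam m.+1)).

Lemma liquidation_short_lt (n : nat) w : (n < m)%N -> V n w = 0.
Proof.
move=> nm; rewrite /V /liquidation_value; cbn [bond shares scale_strategy].
rewrite bond_short_lt ?shares_short_neq; try lia.
by rewrite /pospart /negpart mulr0 oppr0 maxxx; lra.
Qed.

(** Each share was sold for [(1 - lam) * S m] but is bought back at the full price, so the
    transaction cost alone is lost. *)
Lemma liquidation_short_eq w : 0 <= q -> V m w = - (lam * q * S m w * \1_E w).
Proof.
move=> q0; rewrite /V /liquidation_value; cbn [bond shares scale_strategy].
rewrite bond_short_eq shares_short_eq /pospart /negpart -/E mulrN opprK.
have E0 : 0 <= q * \1_E w by rewrite mulr_ge0// indicE; case: (w \in E).
rewrite (_ : Num.max (- _) _ = 0); last by apply/max_idPr; lra.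
by rewrite (_ : Num.max _ _ = q * \1_E w); [lra|apply/max_idPl].
Qed.

Lemma liquidation_short_gt (n : nat) w : (m < n)%N ->
  V n w = q * ((1 - lam) * S m w - S m.+1 w) * \1_E w.
Proof.
move=> mn; rewrite /V /liquidation_value; cbn [bond shares scale_strategy].
rewrite bond_short_gt ?shares_short_neq; try lia.
by rewrite /pospart /negpart mulr0 oppr0 maxxx -/E; lra.
Qed.

End liquidation.

Lemma short_strategy_one_step (d : measure_display) (T : measurableType d)
    (R : realType) (P : probability T R) (xi : nat -> {RV P >-> R})
    (S : nat -> T -> R) (N m : nat) (lam q : R) :
  iid_fair_signs xi -> q != 0 -> (m < N)%N ->
  one_step P N (scale_strategy q (short_strategy xi S lam m.+1)).
Proof.
move=> hxi q0 mN; exists m; split => //; cbn [bond shares scale_strategy].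
- by move=> n w nm; rewrite !bond_short_lt ?shares_short_neq//; lia.
- rewrite (_ : [set w | _] = all_tails xi m).
    by rewrite (probability_all_tails hxi) lte_fin exprn_gt0//; lra.
  apply/seteqP; split => w; rewrite /mkset shares_short_eq mulf_eq0 (negbTE q0) /=.
    by rewrite oppr_eq0 indicE; case: (boolP (w \in _)) => [/set_mem//|_]; rewrite eqxx.
  by move=> h; rewrite oppr_eq0 indicE mem_set//= oner_eq0.
- by move=> w; rewrite shares_short_neq ?mulr0//; lia.
- by move=> n w /andP[mn _]; rewrite !bond_short_gt ?shares_short_neq//; lia.
Qed.

(** * Assembly: thresholds, bound on the losses, probability of a large gain *)

Theorem theorem5p1 (R : realType) (d : measure_display) (T : measurableType d)
  (P : probability T R) (H sigma s0 : R) (xi : nat -> {RV P >-> R}) (nH : nat)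
  (lambda q : nat -> R)
  (hH : 1 / 2 < H < 1) (hsigma : 0 < sigma) (hs0 : 0 < s0)
  (hxi : iid_fair_signs xi)
  (hnH : (1 <= nH)%N)
  (hnH_neg : forall n, (nH <= n)%N ->
     - (\sum_(1 <= i < n) jker H sigma n i) + gker H sigma n < 0)
  (hlambda : forall N, (1 <= N)%N -> 0 < lambda N < 1)
  (hlambda_o : (lambda : nat -> R^o) =o_\oo (fun N => (N%:R `^ H)^-1 : R^o))
  (hq : forall N, (1 <= N)%N -> 0 < q N)
  (hq_oo : q N / N%:R `^ H @[N --> \oo] --> +oo)
  (hlambda_q : lambda N * q N @[N --> \oo] --> 0) :
  one_step_asymptotic_arbitrage1 P (coin_filtration xi)
    (fbm_stock H sigma s0 xi) lambda nH
    (fun N => scale_strategy (q N)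
       (short_strategy xi (fbm_stock H sigma s0 xi N) (lambda N) nH)).
Proof.
have /andP[H12 _] := hH.
case: nH hnH hnH_neg => [//|m] _ /(_ m.+1 (leqnn _)) neg.
split; last first.
  move=> N N1 mN; apply: short_strategy_one_step => //.
  by rewrite gt_eqF// hq// ltnW.
split.
  move=> N N1 mN; split.
    by apply: short_strategy_self_financing; rewrite ltW// hq// ltnW.
  by move=> w; cbn [bond shares scale_strategy];
    rewrite bond_short_lt ?shares_short_neq ?mulr0//; lia.
(* [- a] is the increment at time [m.+1] after [m] tails and one head; it is negative by the choice
   of [nH]. *)
set a := \sum_(1 <= i < m.+1) jker H sigma m.+1 i - gker H sigma m.+1.
have a0 : 0 < a by rewrite /a; lra.
(* The constant path of tails ignores the sample point, so [s N] is a number: the price at time [m]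
   on the all-tails event. *)
pose tails (_ : nat) (_ : T) : R := -1.
pose s N := fbm_stock H sigma s0 tails N m point.
have cvgs : s N @[N --> \oo] --> s0 by apply: fbm_stock_cvg; lra.
(* The constant [a / 2] in the little-o bound lets the cost consume at most half of the relative
   gain [a / N^H]. *)
have [K _ HK] : \forall N \near \oo, [/\ (1 < N)%N, (m < N)%N,
    lambda N <= a / 2 * (N%:R `^ H)^-1, s0 / 2 < s N & s N < 2 * s0].
  near=> N; split.
  - by near: N; exact: nbhs_infty_gt.
  - by near: N; exact: nbhs_infty_gt.
  - near: N; have /eqoP/(_ (a / 2)) := hlambda_o.
    move=> /(_ (divr_gt0 a0 (ltr0Sn _ _))); apply: filterS => N.
    by rewrite [X in _ * X]ger0_norm ?invr_ge0 ?powR_ge0//; exact/le_trans/ler_norm.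
  - by near: N; apply: (cvgr_gt s0) => //; lra.
  - by near: N; apply: (cvgr_lt s0) => //; lra.
pose sub k := (k + K)%N.
have Hsub k : [/\ (1 < sub k)%N, (m < sub k)%N,
    lambda (sub k) <= a / 2 * ((sub k)%:R `^ H)^-1, s0 / 2 < s (sub k) &
    s (sub k) < 2 * s0] by apply: HK; rewrite /= /sub leq_addl.
(* [c] uses the price bound [2 * s0]; [C] multiplies the price bound [s0 / 2] by the remaining half
   gain [a / 2]. *)
pose c k := lambda (sub k) * q (sub k) * (2 * s0).
pose C k := q (sub k) / (sub k)%:R `^ H * (a * s0 / 4).
have qsub k : 0 < q (sub k) by apply: hq; have [/ltnW] := Hsub k.
have lsub k : 0 < lambda (sub k) < 1 by apply: hlambda; have [/ltnW] := Hsub k.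
have psub k : 0 < (sub k)%:R `^ H.
  by rewrite powR_gt0// ltr0n; have [/ltnW] := Hsub k.
have c0 k : 0 < c k.
  by have /andP[? _] := lsub k; rewrite /c !mulr_gt0// qsub.
have C0 k : 0 < C k by rewrite /C !mulr_gt0 ?invr_gt0 ?psub ?qsub.
have stock_tails N w : all_tails xi m w -> fbm_stock H sigma s0 xi N m w = s N.
  by move=> Ew; apply: fbm_stock_eq => i /Ew.
(* Since g >= 0, the increment X is at most -a on all_tails, whichever way the
   last coin falls. *)
have X_le w : all_tails xi m w -> xi m.+1 w = 1 \/ xi m.+1 w = -1 ->
    Xfbm H sigma xi m.+1 w <= - a.
  move=> Ew xiw; rewrite /Xfbm.
  rewrite (_ : \sum_(_ <= _ < _) _ = - \sum_(1 <= i < m.+1) jker H sigma m.+1 i).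
    have := @gker_ge0 R H sigma m.+1 H12 hsigma.
    by rewrite /a; case: xiw => ->; lra.
  rewrite -sumrN; apply: eq_big_nat => i /andP[i1 im].
  by rewrite Ew ?mulrN1// i1 -ltnS.
pose V k := liquidation_value (fbm_stock H sigma s0 xi (sub k)) (lambda (sub k))
  (scale_strategy (q (sub k)) (short_strategy xi
    (fbm_stock H sigma s0 xi (sub k)) (lambda (sub k)) m.+1)).
have V_ge k n w : (m < n)%N -> all_tails xi m w ->
    xi m.+1 w = 1 \/ xi m.+1 w = -1 -> C k <= V k n w.
  move=> mn Ew xiw; rewrite /V liquidation_short_gt//.
  rewrite indicE mem_set// mulr1.
  rewrite (_ : fbm_stock _ _ _ _ _ m.+1 w = (1 + Xfbm H sigma xi m.+1 w /
    (sub k)%:R `^ H) * fbm_stock H sigma s0 xi (sub k) m w)//.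
  rewrite stock_tails//.
  have [_ _ lk sk _] := Hsub k; have := X_le w Ew xiw.
  set X := Xfbm _ _ _ _ _ => Xa; rewrite /C.
  have u0 : 0 < ((sub k)%:R `^ H)^-1 by rewrite invr_gt0.
  set u := (_ `^ H)^-1 in lk u0 *.
  have Xu : X * u <= - a * u by rewrite ler_pM2r.
  have q0 := qsub k.
  (* Both sides are now products with the factor [q (sub k)]: compare [s0 / 2] with the price and
     [a / 2 * u] with the net gain, which is at least [a * u - a / 2 * u]. *)
  rewrite (_ : _ * (_ - _) = q (sub k) * (s (sub k) * (- lambda (sub k) - X * u)));
    last by ring.
  rewrite (_ : _ * _ * _ = q (sub k) * (s0 / 2 * (a / 2 * u))); last by field.
  have au0 : 0 < a * u by rewrite mulr_gt0.
  by rewrite ler_pM2l//; apply: ler_pM; lra.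
exists sub, c, C; split.
- by move=> k l; rewrite /sub ltn_add2r.
- by move=> k; have [? ?] := Hsub k.
- split => //; rewrite -(mul0r (2 * s0)).
  apply: cvgM; last exact: cvg_cst.
  by rewrite (cvg_shiftn K (fun N => lambda N * q N)).
- split => //; have a04 : 0 < a * s0 / 4 by rewrite !mulr_gt0.
  apply: (cvg_comp (fun k => q (sub k) / (sub k)%:R `^ H)
    (fun x => x * (a * s0 / 4)) _ (gt0_cvgMly a04 cvg_id)).
  by rewrite (cvg_shiftn K (fun N => q N / N%:R `^ H)).
split.
  move=> k i ik.
  have := fair_coin_ae hxi m.+1 (ltn0Sn m); apply: filterS => w xiw.
  rewrite -/(V k).
  (* The value is 0 before [m]; after [m] it is at least [C k] on the all-tails event and 0 off it;
     only at [m] can there be a loss, which [c k] bounds. *)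
  have [im|mi|->] := ltngtP i m.
  - by rewrite /V liquidation_short_lt// oppr_le0 ltW.
  - have [Ew|nEw] := pselect (all_tails xi m w).
      by apply: (@le_trans _ _ (C k)); [have := c0 k; have := C0 k; lra|exact: V_ge].
    rewrite /V liquidation_short_gt// indicE memNset// mulr0.
    by rewrite oppr_le0 ltW.
  - rewrite /V liquidation_short_eq ?(ltW (qsub k))// lerN2 /c.
    have [Ew|nEw] := pselect (all_tails xi m w); last first.
      by rewrite indicE memNset// mulr0 (ltW (c0 k)).
    rewrite indicE mem_set//= mulr1 stock_tails//.
    have /andP[l0 _] := lsub k.
    by apply: ler_wpM2l; [rewrite mulr_ge0 ?ltW|have [_ _ _ _ /ltW] := Hsub k].
exists ((1 / 2) ^+ m); first by rewrite exprn_gt0//; lra.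
(* The probability does not depend on [k]: the event [A] below is the all-tails event up to a null
   set. *)
rewrite (_ : (fun k => _) = cst ((1 / 2) ^+ m)%:E); first exact: cvg_cst.
apply/funext => k; rewrite -/(V k) /=.
have [_ mk _ _ _] := Hsub k.
set A := [set w | _].
have mxi i : measurable_fun setT (xi i) by exact: measurable_funPT.
have mE : measurable (all_tails xi m) by exact: measurable_all_tails.
(* As [m < sub k], the terminal value has this closed form, from which [A] is seen to be
   measurable. *)
pose f w := q (sub k) * ((1 - lambda (sub k)) * fbm_stock H sigma s0 xi (sub k) m w -
  fbm_stock H sigma s0 xi (sub k) m.+1 w) * \1_(all_tails xi m) w.
have mf : measurable_fun setT f.
  apply: measurable_funM; last exact: measurable_indic.
  apply: measurable_funM => //; apply: measurable_funB.
    by apply: measurable_funM => //; exact: measurable_fbm_stock.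
  exact: measurable_fbm_stock.
have mA : measurable A.
  rewrite (_ : A = setT `&` f @^-1` `[C k, +oo[); first exact: mf.
  rewrite setTI; apply/seteqP; split => w;
    by rewrite /A /mkset /V liquidation_short_gt//= in_itv/= andbT.
(* Off the all-tails event the value is 0, below [C k > 0]. *)
have AE : A `<=` all_tails xi m.
  move=> w; rewrite /A /mkset /V liquidation_short_gt// indicE.
  by case: (boolP (w \in _)) => [/set_mem//|_]; rewrite mulr0 leNgt C0.
(* By [V_ge], an all-tails path can miss [A] only if coin [m.+1] is neither 1 nor -1. *)
rewrite -(probability_all_tails hxi m) (measureDI P mE mA) setIidr//.
rewrite measure_negligible ?add0e//; first exact: measurableD.
apply: negligibleS (fair_coin_ae hxi m.+1 (ltn0Sn m)) => w [Ew nAw] xiw.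
by apply: nAw; exact: V_ge.
Unshelve. all: by end_near. Qed.
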